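(* Let $k\ge 4$ and let $\delta$ be a set partition of $[k]$ all of whose blocks are singletons except for exactly one block of size two. Let $\sigma_k$ be the partition of $[k]$ into $k$ singletons. Then $|\Pi_n(\delta)|<|\Pi_n(\sigma_k)|$ for all $n>k$. Consequently $\delta\prec\sigma_k$.
   Context: The standardization of a set partition of a finite set $S\subset\mathbb{Z}_{>0}$ replaces the $i$-th smallest element of $S$ by $i$. A set partition $\pi$ of $[n]$ contains $\tau\vdash[k]$ if for some $S\subseteq[n]$ the standardization of the restriction of $\pi$ to $S$ is $\tau$; otherwise it avoids $\tau$. $\Pi_n(\tau)$ is the set of set partitions of $[n]$ avoiding $\tau$. For $\tau,\pi\vdash[k]$, $\tau\prec\pi$ means $|\Pi_n(\tau)|\le|\Pi_n(\pi)|$ for all $n>k$ and there exists $m\ge k$ with $|\Pi_n(\tau)|<|\Pi_n(\pi)|$ for all $n>m$. *)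

(* Defs.v *)
From mathcomp Require Import all_boot.

Set Implicit Arguments.
Unset Strict Implicit.
Unset Printing Implicit Defensive.

(* [n] = {1, ..., n} is represented by 'I_n = {0, ..., n-1}: a set partition of
   [n] is P : {set {set 'I_n}} with partition P [set: 'I_n]. *)

Definition restriction n (P : {set {set 'I_n}}) (S : {set 'I_n}) :
    {set {set 'I_n}} :=
  [set B :&: S | B in P] :\ set0.

(* enum S lists S : {set 'I_n} in increasing order, so enum_val i is the
   element of S with exactly i elements of S below it. *)
Definition standardization n (S : {set 'I_n}) (Q : {set {set 'I_n}}) :
    {set {set 'I_#|S|}} :=
  [set [set i : 'I_#|S| | enum_val i \in B] | B : {set 'I_n} in Q].

(* The equality compares the ground sets [#|S|] and [k] and then the set
   partitions themselves. *)
Definition contains n k (P : {set {set 'I_n}}) (tau : {set {set 'I_k}}) : bool :=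
  [exists S : {set 'I_n},
     Tagged (fun m => {set {set 'I_m}}) (standardization S (restriction P S))
       == Tagged (fun m => {set {set 'I_m}}) tau].

Definition avoiders n k (tau : {set {set 'I_k}}) : {set {set {set 'I_n}}} :=
  [set P : {set {set 'I_n}} | partition P [set: 'I_n] & ~~ contains P tau].

Definition prec k (tau pi : {set {set 'I_k}}) : Prop :=
  (forall n, k < n -> #|avoiders n tau| <= #|avoiders n pi|) /\
  (exists2 m, k <= m &
     forall n, m < n -> #|avoiders n tau| < #|avoiders n pi|).

Definition sigma k : {set {set 'I_k}} := [set [set i] | i : 'I_k].

Definition one_doubleton k (delta : {set {set 'I_k}}) : Prop :=
  exists2 D, D \in delta /\ #|D| = 2 &
    forall B, B \in delta -> B != D -> #|B| = 1.

(* Main.v *)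
Require Import Defs.
From mathcomp Require Import all_boot.
From mathcomp Require Import zify.

(* Let a < b be the two elements of the doubleton of delta and let c be the
   number of elements after b.  Partitions with at most k-2 blocks avoid both
   patterns, so one compares X_n, the delta-avoiders of [n] with at least k-1
   blocks, with A_{k-1}(n), the partitions with exactly k-1 blocks.

   From a partition Q of [n+1] in X_{n+1} delete the element y that immediately
   precedes the shortest suffix meeting c blocks.  That suffix survives in the
   partition P of [n] so obtained, so y is determined by P, and Q is recovered
   from P and the block of P which y joins (if any).  If y joins a block whose
   elements all precede the suffix, then the minimum x of that block together
   with y, the minima of other such blocks, and the suffix form a copy of delta,
   unless fewer than a-1 of these minima are below x or fewer than b-a-1 are
   above x.  So y can join at most (a-1) + (b-a-1) blocks of this kind, one of
   the c blocks of the suffix, or a new block: at most k-1 choices.  Hence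
     |X_{n+1}| <= |A_{k-2}(n)| + (k-1) |X_n|,
   while A_{k-1}(n) satisfies the same recursion with equality.  Strictness is
   obtained for n = k from one explicit partition P of [k] and then propagates. *)

Set Implicit Arguments.
Unset Strict Implicit.
Unset Printing Implicit Defensive.

(** * Set partitions handled through the relation of lying in the same block *)

Section Partitions.

Variable T : finType.
Implicit Types (P Q : {set {set T}}) (rT : eqType).

Lemma mem_pblockE P i j : partition P [set: T] ->
  (j \in pblock P i) = (pblock P i == pblock P j).
Proof. by case/and3P=> /eqP cP tP _; rewrite eq_pblock ?cP ?inE. Qed.

Lemma pblock_partition P i : partition P [set: T] -> pblock P i \in P.
Proof. by case/and3P=> /eqP cP _ _; rewrite pblock_mem ?cP ?inE. Qed.

Lemma partition_blockP P B : partition P [set: T] ->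
  reflect (exists i, B = pblock P i) (B \in P).
Proof.
move=> pP; apply: (iffP idP) => [BP | [i ->]]; last exact: pblock_partition.
have [i iB] : exists i, i \in B.
  by apply/set0Pn; apply: contraTneq BP => ->; case/and3P: pP.
by exists i; rewrite (def_pblock _ BP iB) //; case/and3P: pP.
Qed.

Lemma eq_partition P Q : partition P [set: T] -> partition Q [set: T] ->
  (forall i j, (pblock P i == pblock P j) = (pblock Q i == pblock Q j)) ->
  P = Q.
Proof.
move=> pP pQ eqPQ.
have eqb i : pblock P i = pblock Q i.
  by apply/setP=> j; rewrite !mem_pblockE.
apply/setP=> B; apply/(partition_blockP _ pP)/(partition_blockP _ pQ).
- by case=> i ->; exists i.
- by case=> i ->; exists i.
Qed.

Lemma pblock_preim rT (f : T -> rT) i j :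
  (pblock (preim_partition f setT) i == pblock (preim_partition f setT) j)
    = (f i == f j).
Proof.
rewrite -mem_pblockE ?preim_partitionP //.
rewrite pblock_equivalence_partition ?inE //.
by move=> x y z _ _ _; split=> // /eqP ->.
Qed.

Lemma card_preim_partition (rT : finType) (f : T -> rT) :
  #|preim_partition f setT| = #|f @: setT|.
Proof.
pose h v := [set j | v == f j].
have -> : preim_partition f setT = h @: (f @: setT).
  rewrite -imset_comp; apply: eq_imset => i.
  by apply/setP=> j; rewrite !inE.
rewrite card_in_imset // => v w /imsetP[i _ ->] /imsetP[j _ ->] /setP/(_ i).
by rewrite !inE eqxx => /esym/eqP ->.
Qed.

End Partitions.

(** * Pattern containment in terms of increasing maps *)

Lemma sorted_enum_ord n (S : {set 'I_n}) :
  sorted (relpre val ltn) (enum S).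
Proof.
have -> : enum S = [seq i <- enum 'I_n | i \in S] by rewrite enumT.
apply: sorted_filter; first by move=> x y z /=; apply: ltn_trans.
by rewrite -sorted_map val_enum_ord iota_ltn_sorted.
Qed.

Lemma standardization_eqP n (P : {set {set 'I_n}}) (S : {set 'I_n})
    (tau : {set {set 'I_#|S|}}) :
  partition P [set: 'I_n] -> partition tau [set: 'I_#|S|] ->
  reflect
    (forall i j, (pblock P (enum_val i) == pblock P (enum_val j))
               = (pblock tau i == pblock tau j))
    (standardization S (restriction P S) == tau).
Proof.
move=> pP pt.
have valS (i : 'I_#|S|) : enum_val i \in S by apply: enum_valP.
have stdE B : reflect
    (exists i : 'I_#|S|, B = [set j | pblock P (enum_val i) == pblock P (enum_val j)])
    (B \in standardization S (restriction P S)).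
  apply: (iffP imsetP) => [[C] | [i ->]].
    rewrite !inE => /andP[/set0Pn[x] Cx /imsetP[D DP eC]] ->.
    move: Cx; rewrite eC inE => /andP[xD xS].
    exists (enum_rank_in xS x); apply/setP=> j; rewrite !inE enum_rankK_in //.
    rewrite -mem_pblockE // valS andbT (def_pblock _ DP xD) //.
    by case/and3P: pP.
  exists (pblock P (enum_val i) :&: S); last first.
    by apply/setP=> j; rewrite !inE valS andbT mem_pblockE.
  rewrite !inE; apply/andP; split.
    by apply/set0Pn; exists (enum_val i); rewrite inE valS mem_pblockE ?eqxx.
  by apply/imsetP; exists (pblock P (enum_val i)); rewrite ?pblock_partition.
apply: (iffP eqP) => [e i j | H].
  have : [set j | pblock P (enum_val i) == pblock P (enum_val j)] \in tau.
    by rewrite -e; apply/stdE; exists i.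
  case/and3P: (pt) => _ tt _ Bt.
  by rewrite -(mem_pblockE _ _ pt) (def_pblock tt Bt) inE ?eqxx.
apply/setP=> B; apply/stdE/(partition_blockP _ pt) => [[i ->] | [i ->]];
  exists i; apply/setP=> j; rewrite inE mem_pblockE // H.
Qed.

(** Trades the set [S], whose cardinal occurs in a type, for the increasing map [e] that lists it;
    every later occurrence of a pattern is given as such a map. *)
Lemma containsP n k (P : {set {set 'I_n}}) (tau : {set {set 'I_k}}) :
  partition P [set: 'I_n] -> partition tau [set: 'I_k] ->
  reflect (exists2 e : 'I_k -> 'I_n, {homo e : i j / i < j} &
             forall i j, (pblock P (e i) == pblock P (e j))
                       = (pblock tau i == pblock tau j))
          (contains P tau).
Proof.
move=> pP pt; apply: (iffP existsP) => [[S /eqP H] | [e emono eP]].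
  have E : #|S| = k := congr1 tag H.
  move: tau pt H; rewrite -E => tau pt.
  move/eqP; rewrite eq_Tagged => /(standardization_eqP pP pt) H.
  exists (fun i => enum_val i) => // i j ij.
  have x0 := enum_val i.
  rewrite !(enum_val_nth x0).
  apply: (sorted_ltn_nth (leT := relpre val ltn)) => //.
  - by move=> x y z /=; apply: ltn_trans.
  - exact: sorted_enum_ord.
  - by rewrite inE -cardE.
  - by rewrite inE -cardE.
pose S := e @: [set: 'I_k]; exists S.
have einj : injective e.
  move=> i j eij; apply: val_inj; case: (ltngtP i j) => // /emono;
  by rewrite eij ltnn.
have ES : enum S = [seq e i | i <- enum 'I_k].
  apply: (@irr_sorted_eq _ (relpre val ltn)).
  - by move=> x y z /=; apply: ltn_trans.
  - by move=> x /=; rewrite ltnn.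
  - exact: sorted_enum_ord.
  - rewrite sorted_map; apply: (@sub_sorted _ (relpre val ltn)).
      by move=> x y /=; apply: emono.
    by rewrite -sorted_map val_enum_ord iota_ltn_sorted.
  move=> x; rewrite mem_enum; apply/imsetP/mapP => [[i _ ->]|[i _ ->]];
  by exists i; rewrite ?mem_enum ?inE.
have E : #|S| = k by rewrite cardE ES size_map size_enum_ord.
(* [S] was defined from [k] and [e]; only [ES] is kept about it, so that [k] can be replaced by
   [#|S|]. *)
clearbody S; move: tau pt e eP ES {emono einj}; case: k / E => tau pt e eP ES.
rewrite eq_Tagged; apply/(standardization_eqP pP pt) => i j; rewrite -eP.
have valE (l : 'I_#|S|) : enum_val l = e l.
  rewrite (enum_val_nth (e l)) ES (nth_map l) ?size_enum_ord //.
  by rewrite nth_ord_enum.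
by rewrite !valE.
Qed.

(** Occurrences compose with [f]. For [f = lift y] this shows that deleting [y] preserves
    avoidance. *)
Lemma contains_preim n n' k (P : {set {set 'I_n'}}) (tau : {set {set 'I_k}})
    (f : 'I_n -> 'I_n') :
  partition P [set: 'I_n'] -> partition tau [set: 'I_k] ->
  {homo f : i j / i < j} ->
  contains (preim_partition (pblock P \o f) setT) tau -> contains P tau.
Proof.
move=> pP pt fmono /containsP[]; rewrite ?preim_partitionP // => e emono eP.
apply/containsP => //; exists (f \o e) => [i j /emono/fmono //|i j].
by rewrite -eP pblock_preim.
Qed.

(** The only strictly increasing self-map of ['I_k] is the identity. *)
Lemma contains_eq k (P tau : {set {set 'I_k}}) :
  partition P [set: 'I_k] -> partition tau [set: 'I_k] ->
  contains P tau -> P = tau.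
Proof.
move=> pP pt /containsP[] // e emono eP; apply: eq_partition => // i j.
have eid l : e l = l.
  have geid (h : 'I_k -> 'I_k) (hm : {homo h : i j / i < j}) m :
      forall l : 'I_k, l = m :> nat -> l <= h l.
    elim: m => [|m IH] l0 lm; first by rewrite lm.
    have mk : m < k by have := ltn_ord l0; lia.
    have ml : Ordinal mk < l0 by rewrite /= lm.
    by have := IH (Ordinal mk) erefl; have := hm _ _ ml; rewrite /=; lia.
  (* An increasing self-map satisfies [l <= e l]; conjugation by the reversal gives the opposite
     inequality. *)
  have rmono : {homo (fun i => rev_ord (e (rev_ord i))) : i j / i < j}.
    move=> i' j' ij; have /emono : rev_ord j' < rev_ord i'.
      by rewrite /=; have := ltn_ord i'; have := ltn_ord j'; lia.
    rewrite /=; have := ltn_ord (e (rev_ord i')).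
    by have := ltn_ord (e (rev_ord j')); lia.
  apply: ord_inj; have := geid _ emono l l erefl.
  have := geid _ rmono (rev_ord l) (rev_ord l) erefl; rewrite rev_ordK /=.
  by have := ltn_ord l; have := ltn_ord (e l); lia.
by rewrite -{1}(eid i) -{1}(eid j) eP.
Qed.

(** The [k] elements of an occurrence lie in distinct blocks. *)
Lemma contains_sigma n k (P : {set {set 'I_n}}) :
  partition P [set: 'I_n] -> contains P (sigma k) -> k <= #|P|.
Proof.
move=> pP.
have -> : sigma k = preim_partition id setT.
  have eqB (i : 'I_k) : [set i] = [set j in setT | id i == id j].
    by apply/setP=> j; rewrite !inE eq_sym.
  by apply/setP=> B; apply/imsetP/imsetP=> [[i _ ->]|[i _ ->]]; exists i;
    rewrite ?eqB.
move=> /containsP[] //; first exact: preim_partitionP.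
move=> e _ eP; rewrite -[k in k <= _]card_ord -cardsT.
rewrite -(card_in_imset (f := fun i => pblock P (e i))).
  apply: subset_leq_card; apply/subsetP=> _ /imsetP[i _ ->].
  exact: pblock_partition.
by move=> i j _ _ /eqP; rewrite eP pblock_preim => /eqP.
Qed.

(** * Insertion and deletion of one element *)

Section Insertion.

Variables (n : nat) (y : 'I_n.+1).
Implicit Types (P : {set {set 'I_n}}) (Q : {set {set 'I_n.+1}}).

(* y joins the block Y of P, or forms a new block if Y is empty. *)
Definition ins P (Y : {set 'I_n}) : {set {set 'I_n.+1}} :=
  preim_partition (fun z => if unlift y z is Some i then pblock P i else Y) setT.

Definition del Q : {set {set 'I_n}} :=
  preim_partition (pblock Q \o lift y) setT.

Lemma partition_ins P Y : partition (ins P Y) setT.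
Proof. exact: preim_partitionP. Qed.

Lemma partition_del Q : partition (del Q) setT.
Proof. exact: preim_partitionP. Qed.

Lemma lift_mono : {mono lift y : i j / i < j}.
Proof. by move=> i j; rewrite /= /bump; lia. Qed.

Lemma ins_lift P Y i j :
  (pblock (ins P Y) (lift y i) == pblock (ins P Y) (lift y j))
    = (pblock P i == pblock P j).
Proof. by rewrite pblock_preim !liftK. Qed.

Lemma ins_new P Y i : partition P setT -> Y \in set0 |: P ->
  (pblock (ins P Y) y == pblock (ins P Y) (lift y i)) = (i \in Y).
Proof.
move=> pP; rewrite pblock_preim unlift_none liftK !inE.
case/predU1P => [-> | /(partition_blockP _ pP)[j ->]]; last first.
  by rewrite mem_pblockE.
(* The label [set0] of a new block differs from all other labels, as blocks are nonempty. *)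
rewrite inE; apply/negP => /eqP/setP/(_ i).
by rewrite inE mem_pblockE ?eqxx.
Qed.

Lemma card_ins P Y : partition P setT -> #|ins P Y| = #|Y |: P|.
Proof.
move=> pP; rewrite card_preim_partition; congr #|pred_of_set _|; apply/setP=> B.
apply/imsetP/setU1P => [[z _ ->] | [-> | /(partition_blockP _ pP)[i ->]]].
- by case: unliftP => [i _|_]; [right; apply: pblock_partition | left].
- by exists y; rewrite // unlift_none.
- by exists (lift y i); rewrite // liftK.
Qed.

Lemma ins_del Q : partition Q setT ->
  exists2 Y, Y \in set0 |: del Q & Q = ins (del Q) Y.
Proof.
move=> pQ; pose Y := [set i | pblock Q y == pblock Q (lift y i)].
have delE i j : (pblock (del Q) i == pblock (del Q) j)
    = (pblock Q (lift y i) == pblock Q (lift y j)) by rewrite pblock_preim.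
have pD := partition_del Q.
have YP : Y \in set0 |: del Q.
  apply/setU1P; have [|[i iY]] := set_0Vmem Y; [by left | right].
  apply/(partition_blockP _ pD); exists i; apply/setP => j.
  by move: iY; rewrite mem_pblockE // delE !inE => /eqP ->.
exists Y => //; apply: eq_partition => //; first exact: partition_ins.
move=> i j; case: (unliftP y i) => [i' ->|->]; case: (unliftP y j) => [j' ->|->].
- by rewrite ins_lift delE.
- by rewrite eq_sym [RHS]eq_sym ins_new // inE.
- by rewrite ins_new // inE.
- by rewrite !eqxx.
Qed.

Lemma ins_inj P1 P2 Y1 Y2 : partition P1 setT -> partition P2 setT ->
  Y1 \in set0 |: P1 -> Y2 \in set0 |: P2 -> ins P1 Y1 = ins P2 Y2 ->
  P1 = P2 /\ Y1 = Y2.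
Proof.
move=> pP1 pP2 Y1P Y2P e; split.
  apply: eq_partition => // i j.
  by rewrite -(ins_lift P1 Y1) e ins_lift.
by apply/setP=> i; rewrite -(ins_new i pP1 Y1P) e ins_new.
Qed.

End Insertion.

(** * Blocks meeting a suffix, and the position of insertion *)

Section Cut.

Variable n : nat.
Implicit Types (P : {set {set 'I_n}}).

(** Each block meeting the suffix that starts at [q] is represented by its maximum, so the cardinal
    counts these blocks. *)
Definition tops P (q : nat) : {set 'I_n} :=
  [set i : 'I_n | (q <= i) &&
     [forall j : 'I_n, (pblock P i == pblock P j) ==> (j <= i)]].

Lemma topsP P q (i : 'I_n) :
  reflect (q <= i /\ forall j : 'I_n, pblock P i = pblock P j -> j <= i)
          (i \in tops P q).
Proof.
rewrite inE; apply: (iffP andP) => [[qi /forallP H] | [qi H]]; split=> //.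
  by move=> j /eqP e; have := H j; rewrite e.
by apply/forallP=> j; apply/implyP=> /eqP; apply: H.
Qed.

Lemma tops_inj P q : {in tops P q &, injective (pblock P)}.
Proof.
move=> i j /topsP[_ Hi] /topsP[_ Hj] e; apply: val_inj.
by apply/eqP; rewrite eqn_leq Hi ?Hj.
Qed.

Lemma tops_of P q (i : 'I_n) : q <= i ->
  exists2 j, j \in tops P q & pblock P j = pblock P i.
Proof.
move=> qi.
case: (@arg_maxnP _ i (fun j => pblock P j == pblock P i) val) => [//|j /eqP e H].
exists j => //; apply/topsP; split=> [|l el].
  by apply: leq_trans qi _; apply: H.
by apply: H; rewrite -el e.
Qed.

Lemma card_tops0 P : partition P setT -> #|tops P 0| = #|P|.
Proof.
move=> pP; rewrite -(card_in_imset (@tops_inj P 0)); congr #|pred_of_set _|.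
apply/setP=> B; apply/imsetP/(partition_blockP _ pP) => [[i _ ->]|[i ->]].
  by exists i.
by have [j] := tops_of P (leq0n i); exists j.
Qed.

Lemma tops_sub P q q' : q <= q' -> tops P q' \subset tops P q.
Proof.
move=> le_q; apply/subsetP=> i /topsP[qi H]; apply/topsP; split=> //.
exact: leq_trans qi.
Qed.

Lemma card_topsS P q : #|tops P q| <= #|tops P q.+1|.+1.
Proof.
case: (ltnP q n) => qn; last first.
  rewrite (_ : tops P q = set0) ?cards0 //; apply/setP=> i; rewrite inE [RHS]inE.
  by have := ltn_ord i; lia.
apply: (@leq_trans #|Ordinal qn |: tops P q.+1|).
  apply: subset_leq_card; apply/subsetP=> i /topsP[qi H].
  rewrite in_setU1 -val_eqE /=; move: qi; rewrite leq_eqVlt eq_sym.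
  by case: eqP => //= _ qi; apply/topsP.
by rewrite cardsU1; case: (_ \notin _).
Qed.

Lemma tops_n P : tops P n = set0.
Proof.
by apply/setP=> i; rewrite inE [RHS]inE leqNgt ltn_ord.
Qed.

Variable c : nat.

(* The shortest suffix of P meeting c blocks is {cut P, ..., n-1}.  As a position
   of insertion, cut P is the new element immediately preceding that suffix. *)
Definition cut P : 'I_n.+1 :=
  [arg max_(q > ord0 : 'I_n.+1 | c <= #|tops P q|) (q : nat)].

(** A discrete intermediate value argument: shortening the suffix by one element loses at most one
    block, and the suffix after the cut meets fewer than [c]. *)
Lemma card_tops_cut P : partition P setT -> c <= #|P| ->
  #|tops P (cut P)| = c.
Proof.
move=> pP cP; rewrite /cut; case: arg_maxnP => [|q cq H].
  by rewrite card_tops0.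
apply/eqP; rewrite eqn_leq cq andbT.
have := card_topsS P q; case: (ltnP q n) => qn.
  have := contraNN (H (Ordinal (qn : q.+1 < n.+1))); rewrite /= -!ltnNge.
  by move=> /(_ (ltnSn _)) /[swap] h1 h2; apply: leq_trans h1 h2.
suff -> : q = n :> nat by rewrite tops_n cards0.
by have := ltn_ord q; lia.
Qed.

Lemma cutE P (y : 'I_n.+1) : c <= #|tops P y| ->
  (forall q : 'I_n.+1, y < q -> #|tops P q| < c) -> cut P = y.
Proof.
move=> cy H; rewrite /cut; case: arg_maxnP => [|q cq Hq].
  by apply: leq_trans cy (subset_leq_card (tops_sub _ _)).
apply: ord_inj; apply/eqP; rewrite eqn_leq (Hq _ cy : y <= q) andbT leqNgt.
by apply/negP=> /H; rewrite ltnNge cq.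
Qed.

End Cut.

Lemma lift_ge n (y : 'I_n.+1) (i : 'I_n) : y <= i -> lift y i = i.+1 :> nat.
Proof. by rewrite /= /bump => ->. Qed.

Lemma lift_lt n (y : 'I_n.+1) (i : 'I_n) : i < y -> lift y i = i :> nat.
Proof. by move=> iy; rewrite /= /bump leqNgt iy. Qed.

Lemma lift_mono_le n (y : 'I_n.+1) : {mono lift y : i j / i <= j}.
Proof. by move=> i j; rewrite /= leq_bump2. Qed.

(** Deleting [y] only shifts the later elements by one; a block maximum beyond [y] remains a block
    maximum. *)
Lemma card_tops_del n (Q : {set {set 'I_n.+1}}) (y : 'I_n.+1) q :
  y <= q -> #|tops (del y Q) q| = #|tops Q q.+1|.
Proof.
move=> yq; rewrite -(card_imset _ (@lift_inj _ y)); congr #|pred_of_set _|.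
apply/setP=> z; apply/imsetP/topsP => [[i /topsP[qi H] ->] | [qz H]].
  have yi := leq_trans yq qi.
  split=> [|j]; first by rewrite lift_ge.
  case: (unliftP y j) => [j' ->|->] e; last by rewrite lift_ge // leqW.
  by rewrite lift_mono_le; apply: H; apply/eqP; rewrite pblock_preim /= e.
case: (unliftP y z) => [i zi|zy]; last by move: qz; rewrite zy ltnNge yq.
exists i => //; apply/topsP; rewrite zi in qz H; split.
  by case: (leqP y i) => yi; move: qz; [rewrite lift_ge | rewrite lift_lt // => /ltnW].
move=> j /eqP; rewrite pblock_preim => /eqP /H.
by rewrite lift_mono_le.
Qed.

Lemma cut_del n (Q : {set {set 'I_n.+1}}) c :
  partition Q setT -> c < #|Q| -> exists y, cut c (del y Q) = y.
Proof.
move=> pQ cQ.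
pose q := cut c Q.
have q_gt0 : 0 < q.
  rewrite lt0n; apply/eqP => q0.
  by have := card_tops_cut pQ (ltnW cQ); rewrite -/q q0 card_tops0 //; lia.
(* The element to delete immediately precedes the shortest suffix of [Q]; it exists because all of
   [Q] meets more than [c] blocks. *)
have yn : q.-1 < n.+1 by have := ltn_ord q; lia.
exists (Ordinal yn); apply: cutE => [|r /= yr].
  by rewrite card_tops_del // prednK // card_tops_cut // ltnW.
have qr : Ordinal yn <= r by apply: ltnW.
rewrite card_tops_del // ltnNge; apply/negP => cr.
have : r.+1 < n.+2 by have := ltn_ord r; lia.
move=> rn; have : Ordinal rn <= q; last by rewrite /=; lia.
rewrite /q /cut; case: arg_maxnP => [|q' _]; last by apply.
by rewrite card_tops0 // ltnW.
Qed.

(** * One representative for each block *)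

Section Bots.

Variables (n : nat) (P : {set {set 'I_n}}).

(** The blocks lying wholly before [p], that is those missed by [tops], are represented by their
    minima. *)
Definition bots (p : nat) : {set 'I_n} :=
  [set i : 'I_n |
     [forall j : 'I_n, (pblock P i == pblock P j) ==> (i <= j < p)]].

Lemma botsP (p : nat) (i : 'I_n) :
  reflect (forall j : 'I_n, pblock P i = pblock P j -> i <= j < p)
          (i \in bots p).
Proof.
rewrite inE; apply: (iffP forallP) => H j; last by apply/implyP=> /eqP/H.
by move=> e; have := H j; rewrite e eqxx.
Qed.

Lemma tops_or_bots (p : nat) Y :
  partition P setT -> Y \in P ->
  Y \in pblock P @: tops P p \/ Y \in pblock P @: bots p.
Proof.
move=> pP /(partition_blockP _ pP)[i ->].
have [/existsP[j /andP[pj /eqP <-]]|] :=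
    boolP [exists j : 'I_n, (p <= j) && (pblock P j == pblock P i)].
  have [l lt <-] := tops_of P pj.
  by left; apply: imset_f.
rewrite negb_exists => /forallP Hp; right.
case: (@arg_minnP _ i (fun j => pblock P j == pblock P i) val) => [//|j /eqP ji H].
rewrite -ji; apply: imset_f; apply/botsP=> l jl.
have li : pblock P l == pblock P i by rewrite -jl ji.
by rewrite (H _ li : j <= l) /=; have := Hp l; rewrite li andbT -ltnNge.
Qed.

Definition bots_tops p : seq 'I_n := enum (bots p) ++ enum (tops P p).

Lemma bots_tops_sorted p : sorted (relpre val ltn) (bots_tops p).
Proof.
have tr : transitive (relpre (val : 'I_n -> nat) ltn).
  by move=> x y z /=; apply: ltn_trans.
rewrite sorted_pairwise // pairwise_cat -!sorted_pairwise //.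
rewrite !sorted_enum_ord !andbT; apply/allrelP=> i j.
rewrite !mem_enum => /botsP/(_ i erefl)/andP[_ ip] /topsP[pj _].
exact: leq_trans ip pj.
Qed.

Lemma bots_tops_inj p : {in bots_tops p &, injective (pblock P)}.
Proof.
move=> i j; rewrite !mem_cat !mem_enum.
have mix i' j' : i' \in bots p -> j' \in tops P p ->
    pblock P i' <> pblock P j'.
  by move=> /botsP H /topsP[pj _] /H; rewrite ltnNge pj andbF.
case/orP=> [iB|iT] /orP[jB|jT].
- move=> e; apply: val_inj; apply/eqP; rewrite eqn_leq.
  have /andP[-> _] := botsP _ _ iB _ e.
  by have /andP[-> _] := botsP _ _ jB _ (esym e).
- by move/mix => /(_ iB jT).
- by move/esym/mix => /(_ jB iT).
- exact: tops_inj iT jT.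
Qed.

End Bots.

(** * Insertions that create a copy of delta *)

Section Doubleton.

Variables (k : nat) (delta : {set {set 'I_k}}) (a b : 'I_k).
Hypothesis pdelta : partition delta setT.
Hypothesis ab : a < b.
Hypothesis delta_ab : pblock delta a = pblock delta b.
Hypothesis delta_inj : {in predC1 b &, injective (pblock delta)}.

Lemma contains_doubleton n (P : {set {set 'I_n}}) (e : 'I_k -> 'I_n) :
  partition P setT -> {homo e : i j / i < j} ->
  pblock P (e a) = pblock P (e b) ->
  {in predC1 b &, injective (fun i => pblock P (e i))} ->
  contains P delta.
Proof.
move=> pP emono eab einj; apply/containsP => //; exists e => // i j.
(* Identifying [b] with [a] changes no block in either partition, and on the remaining places both
   block maps are injective. *)
pose r i := if i == b then a else i.
have rb i' : r i' \in predC1 b.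
  rewrite /r inE; case: ifP => [_|->//]; by rewrite -val_eqE /= ltn_eqF.
have rd i' : pblock delta i' = pblock delta (r i').
  by rewrite /r; case: eqP => // ->.
have re i' : pblock P (e i') = pblock P (e (r i')).
  by rewrite /r; case: eqP => // ->.
rewrite (re i) (re j) (rd i) (rd j) (inj_in_eq einj (rb i) (rb j)).
by rewrite (inj_in_eq delta_inj (rb i) (rb j)).
Qed.

Definition extensions n (p : 'I_n.+1) (P : {set {set 'I_n}}) : {set {set 'I_n}} :=
  [set Y in set0 |: P | ~~ contains (ins p P Y) delta].

Lemma contains_ins n (p : 'I_n.+1) (P : {set {set 'I_n}}) (x : 'I_n) :
  partition P setT -> k.-1 - b <= #|tops P p| -> x \in bots P p ->
  a <= index x (enum (bots P p)) ->
  index x (enum (bots P p)) + (b - a) <= #|bots P p| ->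
  contains (ins p P (pblock P x)) delta.
Proof.
move=> pP cp xB; rewrite [#|bots P p|]cardE; set s : seq 'I_n := enum (bots P p).
set idx := index x s => a_idx; rewrite -[size _]/(size s) => idx_b.
set u : seq 'I_n := enum (tops P p); set v := bots_tops P p.
have vE : v = s ++ u by [].
have su : k.-1 - b <= size u by rewrite -cardE.
(* Positions in [v]: the first [a] minima fill the places before [a], then [x] and the minima
   following it fill the places from [a] up to [b], and the maxima in the suffix fill those after
   [b]. The value at [b] is a dummy, since [e] sends [b] to the new element [p]. *)
pose f (i : 'I_k) : nat := if i < a then (i : nat) else
  if i < b then idx + (i - a) else size s + (i - b.+1).
have ltab := ab; have ltk (i : 'I_k) := ltn_ord i.
have fs (i : 'I_k) : i < b -> f i < size s.
  by move=> ib; rewrite /f ib; case: (ltnP i a) => ?; lia.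
have fu (i : 'I_k) : b < i -> f i = size s + (i - b.+1).
  by move=> ib; rewrite /f !ifF //; apply/negbTE; rewrite -leqNgt; lia.
have fv (i : 'I_k) : i != b -> f i < size v.
  rewrite -val_eqE /= neq_ltn vE size_cat => /orP[/fs|bi].
    exact: ltn_addr.
  by rewrite fu // ltn_add2l; have := ltk i; lia.
have fmono (i j : 'I_k) : i != b -> j != b -> i < j -> f i < f j.
  rewrite -!val_eqE /= => ib jb ij; rewrite /f; case: (ltnP i a) => ?;
  by case: (ltnP j a) => ?; case: (ltnP i b) => ?; case: (ltnP j b) => ?; lia.
have finj (i j : 'I_k) : i != b -> j != b -> f i = f j -> i = j.
  move=> ib jb e; apply: val_inj; case: (ltngtP i j) => // /fmono.
    by move=> /(_ ib jb); rewrite e ltnn.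
  by move=> /(_ jb ib); rewrite e ltnn.
have vs (i : 'I_k) : i < b -> nth x v (f i) < p.
  move=> /fs fi; have : nth x v (f i) \in bots P p.
    by rewrite vE nth_cat fi -mem_enum mem_nth.
  by move=> /botsP/(_ _ erefl)/andP[].
have vu (i : 'I_k) : b < i -> p <= nth x v (f i).
  move=> bi; have : nth x v (f i) \in tops P p.
    rewrite vE fu // nth_cat ltnNge leq_addr /= addKn -mem_enum mem_nth //.
    by apply: leq_trans su; have := ltk i; lia.
  by move=> /topsP[].
have v_nth (i : 'I_k) : i != b -> nth x v (f i) \in v by move/fv/mem_nth.
have v_lt (i j : 'I_k) : i != b -> j != b -> i < j ->
    nth x v (f i) < nth x v (f j).
  move=> ib jb ij; apply: (sorted_ltn_nth (leT := relpre val ltn)) => //.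
  - by move=> ? ? ? /=; apply: ltn_trans.
  - exact: bots_tops_sorted.
  - exact: fv.
  - exact: fv.
  - exact: fmono.
have v_inj (i j : 'I_k) : i != b -> j != b ->
    pblock P (nth x v (f i)) = pblock P (nth x v (f j)) -> i = j.
  move=> ib jb /bots_tops_inj e; have {}e := e _ (v_nth _ ib) (v_nth _ jb).
  apply: val_inj; case: (ltngtP i j) => // /v_lt.
    by move=> /(_ ib jb); rewrite e ltnn.
  by move=> /(_ jb ib); rewrite e ltnn.
have xP : pblock P x \in set0 |: P.
  by rewrite in_setU1 pblock_partition ?orbT.
have ab' : a != b by rewrite -val_eqE /= ltn_eqF.
pose e (i : 'I_k) : 'I_n.+1 := if i == b then p else lift p (nth x v (f i)).
apply: (@contains_doubleton _ _ e).
- exact: partition_ins.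
- move=> i j ij; rewrite /e; case: (eqVneq i b) => ib; case: (eqVneq j b) => jb.
  + by move: ij; rewrite ib jb ltnn.
  + have bj : b < j by rewrite -ib.
    by rewrite lift_ge ?vu // ltnS vu.
  + have bj : i < b by rewrite -jb.
    by rewrite lift_lt ?vs.
  + by rewrite lift_mono v_lt.
- apply/eqP; rewrite /e eqxx (negbTE ab') eq_sym ins_new // mem_pblockE //.
  rewrite /f ltnn ltab subnn addn0 vE nth_cat index_mem mem_enum xB nth_index //.
  by rewrite mem_enum.
move=> i j; rewrite !inE /e => ib jb; rewrite (negbTE ib) (negbTE jb).
by move/eqP; rewrite ins_lift => /eqP /v_inj; apply.
Qed.

Lemma card_extensions n (p : 'I_n.+1) (P : {set {set 'I_n}}) :
  partition P setT -> #|tops P p| = k.-1 - b -> #|extensions p P| <= k.-1.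
Proof.
move=> pP cp; pose s : seq 'I_n := enum (bots P p); pose m := size s - (b - a).-1.
pose F (t : seq 'I_n) := [set pblock P i | i in t].
have cF t : #|F t| <= size t.
  exact: leq_trans (leq_imset_card _ _) (card_size _).
(* The possible choices: a new block, the [k.-1 - b] blocks of the suffix, and the blocks of the
   first [a] and the last [b - a - 1] minima. They add up to [k.-1]. *)
apply: (@leq_trans #|set0 |: (pblock P @: tops P p :|:
                      (F (take a s) :|: F (drop m s)))|).
  apply: subset_leq_card; apply/subsetP=> Y; rewrite inE in_setU1 => /andP[].
  case/predU1P => [-> _|YP]; first by rewrite setU11.
  apply: contraR; rewrite in_setU1 !in_setU !negb_or => /and4P[_ Yt Ya Ym].
  have [|/imsetP[x xB eY]] := tops_or_bots p pP YP; first by rewrite (negbTE Yt).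
  have xs : x \in s by rewrite mem_enum.
  rewrite eY; apply: contains_ins => //; first by rewrite cp.
    rewrite leqNgt -/s -in_take //; apply: contraNN Ya => xa.
    by rewrite eY; apply/imsetP; exists x.
  rewrite cardE -[size _]/(size s) -/s.
  suff : index x s < m.
    by rewrite /m ltn_subRL addnC -addnS prednK // subn_gt0.
  rewrite ltnNge; apply: contraNN Ym => mx.
  rewrite eY; apply/imsetP; exists x => //.
  rewrite -(nth_index x xs) -(subnKC mx) -nth_drop mem_nth // size_drop.
  by have := xs; rewrite -index_mem; lia.
apply: leq_trans (leq_card_setU _ _) _; rewrite cards1.
apply: (@leq_trans (1 + ((k.-1 - b) + (a + (b - a).-1)))); last first.
  by have := ltn_ord b; move: ab; lia.
rewrite leq_add2l; apply: leq_trans (leq_card_setU _ _) _; apply: leq_add.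
  by rewrite -cp leq_imset_card.
apply: leq_trans (leq_card_setU _ _) _; apply: leq_add.
  by apply: leq_trans (cF _) _; rewrite size_take; case: ltnP.
by apply: leq_trans (cF _) _; rewrite size_drop /m leq_subLR addnC -leq_subLR.
Qed.

(** * Recursive bounds for both counts *)

Definition parts n j : {set {set {set 'I_n}}} :=
  [set P : {set {set 'I_n}} | partition P setT & #|P| == j].

Lemma card_dep_pairs (T1 T2 : finType) (A : {set T1}) (F : T1 -> {set T2}) :
  #|[set u : T1 * T2 | (u.1 \in A) && (u.2 \in F u.1)]| = \sum_(x in A) #|F x|.
Proof.
rewrite -sum1_card.
under [RHS]eq_bigr do rewrite -sum1_card.
by rewrite pair_big_dep /=; apply: eq_bigl => u; rewrite inE.
Qed.

Lemma card_setU_disjoint (T : finType) (A B : {set T}) :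
  [disjoint A & B] -> #|A :|: B| = #|A| + #|B|.
Proof. by move=> dAB; apply/eqP; rewrite (leq_card_setU A B).2. Qed.

(** From the recurrence of the Stirling numbers of the second kind: the last element is added as a
    singleton ([V]) or to one of [j.+1] blocks ([W]). *)
Lemma leq_card_parts n j :
  #|parts n j| + j.+1 * #|parts n j.+1| <= #|parts n.+1 j.+1|.
Proof.
pose W := [set u : {set {set 'I_n}} * {set 'I_n} |
             (u.1 \in parts n j.+1) && (u.2 \in u.1)].
pose V := setX (parts n j) [set (set0 : {set 'I_n})].
have dVW : [disjoint V & W].
  rewrite -setI_eq0; apply/eqP/setP=> -[P Y]; rewrite !inE /=.
  by case: (#|P| =P j) => [->|_]; rewrite ?(ltn_eqF (ltnSn j)) !andbF.
have <- : #|W| = j.+1 * #|parts n j.+1|.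
  rewrite (card_dep_pairs (parts n j.+1) id) (eq_bigr (fun=> j.+1)).
    by rewrite sum_nat_const mulnC.
  by move=> P; rewrite inE => /andP[_ /eqP].
have <- : #|V| = #|parts n j| by rewrite cardsX cards1 muln1.
rewrite -card_setU_disjoint //.
have VWE u : u \in V :|: W ->
    [/\ partition u.1 setT, u.2 \in set0 |: u.1 & #|u.2 |: u.1| = j.+1].
  case: u => P Y; rewrite in_setU => /orP[].
    rewrite !inE /= => /andP[/andP[pP /eqP cP] /eqP ->].
    split=> //=; first by rewrite eqxx.
    by rewrite cardsU1 cP; case/and3P: pP => _ _ ->.
  rewrite inE /= inE => /andP[/andP[pP /eqP cP] YP].
  split=> //=; first by rewrite setU1r.
  by rewrite (setUidPr _) // sub1set.
rewrite -(card_in_imset (f := fun u => ins ord_max u.1 u.2)); last first.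
  move=> [P Y] [P' Y'] /VWE[pP YP _] /VWE[pP' YP' _] /=.
  by case/ins_inj => // -> ->.
apply: subset_leq_card; apply/subsetP=> _ /imsetP[u /VWE[pP YP cP] ->].
by rewrite inE partition_ins card_ins // cP eqxx.
Qed.

(** The set [X_n] of the overview. *)
Definition large n : {set {set {set 'I_n}}} :=
  [set P in avoiders n delta | k.-1 <= #|P|].

(** As [b] is numbered from 0, this is the number of elements after it. *)
Let c := k.-1 - b.

(** A refined form of the recursion which keeps both sources of slack: partitions with [k.-2] blocks
    whose extension by a singleton contains delta, and partitions with fewer than [k.-1]
    extensions. *)
Lemma leq_card_large n :
  #|large n.+1| <=
    #|[set P in parts n k.-2 | ~~ contains (ins (cut c P) P set0) delta]|
    + \sum_(P in large n) #|extensions (cut c P) P|.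
Proof.
set U := [set P in parts n k.-2 | _].
pose W := [set u : {set {set 'I_n}} * {set 'I_n} |
             (u.1 \in large n) && (u.2 \in extensions (cut c u.1) u.1)].
have <- : #|W| = \sum_(P in large n) #|extensions (cut c P) P|.
  by rewrite (card_dep_pairs _ (fun P => extensions (cut c P) P)).
apply: (@leq_trans #|(fun P => ins (cut c P) P set0) @: U :|:
                     (fun u => ins (cut c u.1) u.1 u.2) @: W|); last first.
  apply: leq_trans (leq_card_setU _ _) _.
  by apply: leq_add; apply: leq_imset_card.
apply: subset_leq_card; apply/subsetP=> Q.
rewrite !inE => /andP[/andP[pQ avQ] cQ].
have cQ' : c < #|Q| by apply: leq_trans cQ; rewrite /c; have := ltn_ord b; lia.
have [y cuty] := cut_del pQ cQ'.
have [Y YP eQ] := ins_del y pQ.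
have pP := partition_del y Q.
have cP : #|Q| = #|Y |: del y Q| by rewrite {1}eQ card_ins.
have avP : ~~ contains (del y Q) delta.
  by apply: contraNN avQ; apply: contains_preim => // i j; rewrite lift_mono.
(* If deletion leaves fewer than [k.-1] blocks, then [y] was a singleton and exactly [k.-2] blocks
   remain. *)
case: (leqP k.-1 #|del y Q|) => cD; apply/orP.
  right; apply/imsetP; exists (del y Q, Y); last by rewrite /= cuty.
  by rewrite !inE /= cuty -in_setU1 YP pP avP cD -eQ avQ.
have YnP : Y \notin del y Q.
  by apply: contraTN cD => YD; move: cQ; rewrite -leqNgt cP cardsU1 YD.
have Y0 : Y = set0 by move: YP; rewrite in_setU1 (negbTE YnP) orbF => /eqP.
left; apply/imsetP; exists (del y Q); last by rewrite cuty -Y0.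
rewrite !inE cuty -Y0 -eQ avQ andbT pP /=.
by move: cQ cD; rewrite cP cardsU1 YnP; move: #|_| => d; lia.
Qed.

Lemma sum_extensions_leq n (A : {set {set {set 'I_n}}}) : A \subset large n ->
  \sum_(P in A) #|extensions (cut c P) P| <= k.-1 * #|A|.
Proof.
move=> /subsetP AL; rewrite mulnC -sum_nat_const; apply: leq_sum => P /AL.
rewrite !inE => /andP[/andP[pP _] cP]; apply: card_extensions => //.
apply: card_tops_cut => //; apply: leq_trans cP; apply: leq_subr.
Qed.

Lemma leq_card_largeS n :
  #|large n.+1| <= #|parts n k.-2| + k.-1 * #|large n|.
Proof.
apply: leq_trans (leq_card_large n) _.
apply: leq_add (sum_extensions_leq (subxx _)).
by apply: subset_leq_card; apply/subsetP=> P; rewrite inE => /andP[].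
Qed.

Lemma k_gt1 : 1 < k.
Proof. by have := ltn_ord b; move: ab; lia. Qed.

Lemma leq_card_partsS n :
  #|parts n k.-2| + k.-1 * #|parts n k.-1| <= #|parts n.+1 k.-1|.
Proof. by have := leq_card_parts n k.-2; rewrite prednK //; have := k_gt1; lia. Qed.

Lemma leq_large_parts n : #|large n| <= #|parts n k.-1|.
Proof.
elim: n => [|n IH].
  rewrite (_ : large 0 = set0) ?cards0 //; apply/setP=> P; rewrite !inE.
  apply/negP=> /andP[/andP[pP _]]; apply/negP; rewrite -ltnNge.
  suff -> : P = set0 by rewrite cards0; have := k_gt1; lia.
  apply/setP=> B; rewrite inE; apply/(partition_blockP _ pP) => -[[]] //.
apply: leq_trans (leq_card_largeS n) _; apply: leq_trans (leq_card_partsS n).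
by rewrite leq_add2l leq_mul2l IH orbT.
Qed.

Lemma ltn_large_parts n :
  #|large k.+1| < #|parts k.+1 k.-1| -> k < n -> #|large n| < #|parts n k.-1|.
Proof.
move=> H; elim: n => // n IH; rewrite ltnS leq_eqVlt => /predU1P[<- //|kn].
apply: leq_ltn_trans (leq_card_largeS n) _.
apply: leq_trans (leq_card_partsS n).
by rewrite ltn_add2l ltn_mul2l IH // andbT; have := k_gt1; lia.
Qed.

(** * Strictness for partitions of a set of k+1 elements *)

Lemma card_ord_geq n q : #|[set i : 'I_n | q <= i]| = n - q.
Proof.
rewrite cardsE -sum1_card -(big_geq_mkord _ _ predT (fun=> 1)).
by rewrite sum_nat_const_nat muln1.
Qed.

(* Here P0 has the block {a, b, b+1}: giving it a new singleton between b and
   b+1 creates a copy of delta (without the old b+1). *)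
Lemma ltn_large_b (bk : b.+1 < k) : #|large k.+1| < #|parts k.+1 k.-1|.
Proof.
have k1 := k_gt1.
pose b1 : 'I_k := Ordinal bk.
pose g (i : 'I_k) := if (i == b) || (i == b1) then a else i.
pose P0 := preim_partition g setT.
have pP0 : partition P0 setT by apply: preim_partitionP.
pose y : 'I_k.+1 := lift ord0 b.
have yE : y = b.+1 :> nat by [].
have ab' : a != b by rewrite -val_eqE /= ltn_eqF.
have ab1 : a != b1 by rewrite -val_eqE /= ltn_eqF // leqW.
have bb1 : b != b1 by rewrite -val_eqE /= ltn_eqF.
have gid i : i != b -> i != b1 -> g i = i.
  by move=> ib ib1; rewrite /g (negbTE ib) (negbTE ib1).
have gb : g b = a by rewrite /g eqxx.
have topsE q : b < q -> tops P0 q = [set i : 'I_k | q <= i].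
  move=> bq; apply/setP=> i; rewrite [RHS]inE; apply/topsP/idP => [[] //|qi].
  split=> // j /eqP; rewrite pblock_preim leqNgt => /eqP e; apply/negP=> ij.
  have bi : b < i := leq_trans bq qi.
  have bj : b1 < j := leq_ltn_trans bi ij.
  move: e; rewrite (gid j) -?val_eqE ?gtn_eqF //; last exact: ltnW.
  rewrite /g; case: ifP => _ e; move: ij; rewrite -e ?ltnn //.
  by rewrite ltnNge (leq_trans (ltnW ab) (ltnW bi)).
(* The elements from [b.+1] on lie in distinct blocks and there are exactly [c] of them. *)
have cutP0 : cut c P0 = y.
  apply: cutE => [|q yq]; first by rewrite topsE ?yE // card_ord_geq /c; lia.
  have bq : b.+1 < q by rewrite -yE.
  by rewrite topsE ?card_ord_geq /c; lia.
have P0parts : P0 \in parts k k.-2.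
  rewrite inE pP0 card_preim_partition /=.
  have -> : g @: setT = ~: [set b; b1].
    apply/setP=> i; rewrite !inE negb_or; apply/imsetP/andP => [[j _ ->]|[ib ib1]].
      by rewrite /g; case: ifP => [_|/norP[]]; rewrite ?ab' ?ab1.
    by exists i; rewrite ?gid.
  by rewrite cardsCs setCK cards2 bb1 card_ord subn2.
have P0c : contains (ins y P0 set0) delta.
  have s0 : set0 \in set0 |: P0 by rewrite setU11.
  (* The new singleton replaces the old [b1], while [a] and [b] still share a block. *)
  pose e i := if i == b1 then y else lift y i.
  apply: (@contains_doubleton _ _ e).
  - exact: partition_ins.
  - move=> i j ij; rewrite /e; case: (eqVneq i b1) => ib; case: (eqVneq j b1) => jb.
    + by move: ij; rewrite ib jb ltnn.
    + have bj : b1 < j by rewrite -ib.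
      have yj : y <= j by rewrite yE; apply: ltnW.
      by rewrite lift_ge.
    + have bj : i < b1 by rewrite -jb.
      by rewrite lift_lt ?yE.
    + by rewrite lift_mono.
  - apply/eqP; rewrite /e (negbTE ab1) (negbTE bb1) ins_lift pblock_preim gb.
    by rewrite gid.
  move=> i j; rewrite !inE /e => ib jb /eqP.
  case: (eqVneq i b1) => [-> | ib1]; case: (eqVneq j b1) => [-> // | jb1].
  - by rewrite ins_new // inE.
  - by rewrite eq_sym ins_new // inE.
  by rewrite ins_lift pblock_preim !gid // => /eqP.
apply: leq_ltn_trans (leq_card_large k) _.
apply: leq_trans (leq_card_partsS k).
(* The strict gain is in the first summand, from which [P0] is missing. *)
rewrite -addSn; apply: leq_add; last first.
  apply: leq_trans (sum_extensions_leq (subxx _)) _.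
  by rewrite leq_mul2l leq_large_parts orbT.
apply: proper_card; apply/properP; split.
  by apply/subsetP=> P; rewrite inE => /andP[].
by exists P0 => //; rewrite inE cutP0 P0c andbF.
Qed.

(* Here P0 has the block {0, q}.  A new last element creates a copy of delta when
   it joins the block of a (without q) as well as that of a+1 (without 0), which
   are distinct blocks because q > 1. *)
Lemma ltn_large_last (bk : b = k.-1 :> nat) (hk : 4 <= k) :
  #|large k.+1| < #|parts k.+1 k.-1|.
Proof.
have k1 := k_gt1.
have z0k : 0 < k by apply: ltnW.
pose z0 : 'I_k := Ordinal z0k.
have a1k : a.+1 < k by have := ltn_ord b; move: ab; lia.
pose a1 : 'I_k := Ordinal a1k.
(* For [a = 0] the choice [k.-1] would make [P0] equal to delta, hence [k.-2], which still exceeds 1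
   because [4 <= k]. *)
have qk : (if a == z0 then k.-2 else k.-1) < k by case: ifP => _; lia.
pose q : 'I_k := Ordinal qk.
have qE : q = (if a == z0 then k.-2 else k.-1) :> nat by [].
pose f (i : 'I_k) := if i == q then z0 else i.
pose P0 := preim_partition f setT.
have pP0 : partition P0 setT by apply: preim_partitionP.
have a_q : a < q.
  by rewrite qE; case: eqP => [->|_] /=; [lia | rewrite -bk].
have z0_q : z0 < q by rewrite qE /=; case: ifP => _; lia.
have a1_q : a1 == q -> a != z0.
  by rewrite -val_eqE /=; case: (eqVneq a z0) => [->|//] /=; lia.
have qz : q != z0 by rewrite -val_eqE /= gtn_eqF.
have zq : z0 != q by rewrite eq_sym.
have fq : f q = z0 by rewrite /f eqxx.
have fid i : i != q -> f i = i by rewrite /f => /negbTE ->.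
have faq : f a = a by rewrite fid // -val_eqE /= ltn_eqF.
(* Possibly [a1] is [q] and shares the block of 0; then [a] is not 0, so the two blocks still
   differ. *)
have fa1 : f a != f a1.
  rewrite faq /f; case: ifP => [/a1_q // | _].
  by rewrite -val_eqE /= ltn_eqF.
have f_inj_q : {in predC1 q &, injective f}.
  by move=> i j; rewrite !inE => iq jq; rewrite !fid.
have f_inj_0 : {in predC1 z0 &, injective f}.
  move=> i j; rewrite !inE /f => iz jz.
  case: eqP => [->|_]; case: eqP => [-> //|_] //.
  - by move=> e; rewrite -e eqxx in jz.
  - by move=> e; rewrite e eqxx in iz.
(* Here [b] is last, so [c] is 0, the suffix is empty and insertion is at the end. *)
have cutP0 : cut c P0 = ord_max.
  apply: cutE => [|r]; first by rewrite /c bk subnn.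
  by rewrite /= ltnNge -ltnS ltn_ord.
have cardP0 : #|P0| = k.-1.
  rewrite card_preim_partition.
  have -> : f @: setT = ~: [set q].
    apply/setP=> i; rewrite !inE; apply/imsetP/idP => [[j _ ->]|iq].
      by rewrite /f; case: (eqVneq j q).
    by exists i; rewrite ?fid.
  by rewrite cardsCs setCK cards1 card_ord subn1.
have P0n : ~~ contains P0 delta.
  apply/negP=> /contains_eq => /(_ pP0 pdelta) e.
  have : pblock delta z0 == pblock delta q.
    by rewrite -e pblock_preim fq fid.
  case: (eqVneq a z0) => [az | anz].
    move=> /eqP/delta_inj; rewrite !inE -!val_eqE /= az eqxx bk => H.
    have : z0 = q by apply: H; lia.
    by move/eqP; rewrite (negbTE zq).
  have -> : q = b by apply: val_inj; rewrite /= (negbTE anz) bk.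
  rewrite -delta_ab => /eqP/delta_inj; rewrite !inE -!val_eqE /= => H.
  have : z0 = a by apply: H; move: ab; lia.
  by move/eqP; rewrite eq_sym (negbTE anz).
have P0L : P0 \in large k by rewrite !inE pP0 P0n cardP0 leqnn.
(* The copy of delta omits [r], which moves place [a] to [x] and place [b] to the new last element.
   It is applied with [r = q], [x = a] and with [r = z0], [x = a1]. *)
have cont (x r : 'I_k) : bump r a = x -> {in predC1 r &, injective f} ->
    contains (ins ord_max P0 (pblock P0 x)) delta.
  move=> ra finj.
  have xP : pblock P0 x \in set0 |: P0.
    by rewrite in_setU1 pblock_partition ?orbT.
  pose r' : 'I_k.+1 := lift ord_max r.
  have r'E : r' = r :> nat by rewrite lift_lt //=.
  have eb : lift r' b = ord_max.
    have rb : r' <= b by rewrite r'E bk -ltnS prednK.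
    by apply: ord_inj; rewrite lift_ge // bk prednK.
  have eP i : i != b -> exists2 i', lift r' i = lift ord_max i' & i' != r.
    move=> ib; case: (unliftP ord_max (lift r' i)) => [i' e|e].
      exists i' => //; apply: contra_eq_neq e => ->.
      by rewrite -/r' eq_sym neq_lift.
    by case/eqP: ib; apply: (@lift_inj _ r'); rewrite e eb.
  have ea : lift r' a = lift ord_max x.
    by apply: ord_inj; rewrite [RHS]lift_lt // -ra -r'E.
  apply: (@contains_doubleton _ _ (lift r')).
  - exact: partition_ins.
  - by move=> i j; rewrite lift_mono.
  - by apply/eqP; rewrite ea eb eq_sym ins_new // mem_pblockE.
  move=> i j; rewrite !inE => /eP[i' ei i'r] /eP[j' ej j'r].
  rewrite ei ej => /eqP; rewrite ins_lift pblock_preim => /eqP/finj.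
  rewrite !inE => /(_ i'r j'r) e; apply: (@lift_inj _ r').
  by rewrite ei ej e.
have extP0 : #|extensions (cut c P0) P0| < k.-1.
  rewrite cutP0; have pa : pblock P0 a \in P0 by apply: pblock_partition.
  have pa1 : pblock P0 a1 \in P0 by apply: pblock_partition.
  (* Of the [k] candidates in [set0 |: P0] two are excluded, which leaves [k - 2]. *)
  apply: (@leq_ltn_trans #|(set0 |: P0) :\: [set pblock P0 a; pblock P0 a1]|).
    apply: subset_leq_card; apply/subsetP=> Y; rewrite !inE => /andP[-> nc].
    rewrite andbT; apply: contraNN nc => /orP[] /eqP ->.
      apply: (cont a q) => //; by rewrite /bump leqNgt a_q.
    by apply: (cont a1 z0).
  rewrite cardsD (setIidPr _); last first.
    by apply/subsetP=> Y /set2P[] ->; rewrite setU1r.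
  have -> : #|set0 |: P0| = k.
    by rewrite cardsU1 cardP0; case/and3P: pP0 => _ _ ->; rewrite add1n prednK.
  by rewrite cards2 pblock_preim fa1 /=; lia.
apply: leq_ltn_trans (leq_card_large k) _.
apply: leq_trans (leq_card_partsS k).
rewrite -addnS; apply: leq_add.
  by apply: subset_leq_card; apply/subsetP=> P; rewrite inE => /andP[].
apply: (@leq_trans (k.-1 * #|large k|)); last first.
  by rewrite leq_mul2l leq_large_parts orbT.
(* The strict gain is the term of [P0] in the sum over [large k]. *)
rewrite (bigD1 P0 P0L) (cardsD1 P0) P0L mulnDr muln1 -addSn leq_add //.
rewrite (eq_bigl (fun P => P \in large k :\ P0)) => [|P].
  exact: sum_extensions_leq (subD1set _ _).
by rewrite in_setD1 andbC.
Qed.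

(** * Comparison of all avoiders *)

Lemma ltn_avoiders (hk : 4 <= k) n :
  k < n -> #|avoiders n delta| < #|avoiders n (sigma k)|.
Proof.
move=> kn; have k1 := k_gt1.
have base : #|large k.+1| < #|parts k.+1 k.-1|.
  case: (ltnP b.+1 k) => [|kb]; first exact: ltn_large_b.
  by apply: ltn_large_last => //; have := ltn_ord b; lia.
have lt_n := ltn_large_parts base kn.
(* The avoiders of delta lie in [small] or [large n], while [small] and [parts n k.-1] are disjoint
   and have fewer than [k] blocks, so they avoid [sigma k]. *)
pose small := [set P : {set {set 'I_n}} | partition P setT & #|P| < k.-1].
apply: (@leq_ltn_trans (#|small| + #|large n|)).
  apply: leq_trans (leq_card_setU small (large n)).
  apply: subset_leq_card; apply/subsetP=> P; rewrite !inE => /andP[-> ->].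
  by rewrite /= ltnNge orNb.
apply: (@leq_trans (#|small| + #|parts n k.-1|)); first by rewrite ltn_add2l.
rewrite -card_setU_disjoint; last first.
  rewrite -setI_eq0; apply/eqP/setP=> P; rewrite !inE.
  by case: (#|P| =P k.-1) => [->|_]; rewrite ?ltnn !andbF.
apply: subset_leq_card; apply/subsetP=> P; rewrite !inE -andb_orr => /andP[pP cP].
rewrite pP; apply/negP => /(contains_sigma pP).
by case/orP: cP => [cP|/eqP ->]; lia.
Qed.

End Doubleton.

(** Two elements other than [b] in a common block coincide: the block is a singleton, or it is [D],
    where only [a] is left. *)
Lemma one_doubletonP k (delta : {set {set 'I_k}}) :
  partition delta setT -> one_doubleton delta ->
  exists a b : 'I_k, [/\ a < b, pblock delta a = pblock delta b &
    {in predC1 b &, injective (pblock delta)}].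
Proof.
move=> pd [D [Dd /eqP/cards2P[x [y [xy eD]]]] H].
have {x y xy eD} [a [b [ab eD]]] : exists a b : 'I_k, a < b /\ D = [set a; b].
  move: xy; rewrite -val_eqE neq_ltn => /orP[] ?; [exists x, y | exists y, x] => //.
  by rewrite setUC.
have td : trivIset delta by case/and3P: pd.
have Da : pblock delta a = D by apply: def_pblock; rewrite // eD !inE eqxx.
have Db : pblock delta b = D by apply: def_pblock; rewrite // eD !inE eqxx orbT.
exists a, b; split=> // [|i j]; first by rewrite Da.
rewrite !inE => ib jb e.
have ji : j \in pblock delta i by rewrite mem_pblockE // e.
have ii : i \in pblock delta i by rewrite mem_pblockE.
have [eiD | niD] := eqVneq (pblock delta i) D.
  move: ji ii; rewrite eiD eD !inE (negbTE ib) (negbTE jb) !orbF.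
  by move=> /eqP -> /eqP ->.
have /eqP/cards1P[z ez] := H _ (pblock_partition i pd) niD.
by move: ji ii; rewrite ez !inE => /eqP -> /eqP ->.
Qed.

Theorem theorem3p4 (k : nat) (delta : {set {set 'I_k}})
    (hk : 4 <= k)
    (hpart : partition delta [set: 'I_k])
    (hdelta : one_doubleton delta) :
  (forall n : nat, k < n -> #|avoiders n delta| < #|avoiders n (sigma k)|) /\
  prec delta (sigma k).
Proof.
have [a [b [ab eab inj]]] := one_doubletonP hpart hdelta.
have lt n := @ltn_avoiders k delta a b hpart ab eab inj hk n.
by split=> //; split=> [n /lt/ltnW //|]; exists k.
Qed.
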